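(* For any integer $t \ge 2$, any integer $N\ge 4$ and any reals $m,r$ satisfying $$\log m \ge t^{2t}(\log r)^{t} (\log N)^{1/t}\quad\text{and}\quad \log r \ge t\log \log N,$$ there exists an $(m,r)$-locally Ramsey graph on $N$ vertices.
   Context: All logarithms are base $2$. For a graph $G$ and reals $m,r>0$ (not necessarily integers), $G$ is called $(m,r)$-locally Ramsey if every set of at least $m$ vertices of $G$ contains both a clique and an independent set of size at least $r$. *)

(* Defs.v *)
From mathcomp Require Import all_boot.
From Stdlib Require Import Reals.

Set Implicit Arguments.
Unset Strict Implicit.
Unset Printing Implicit Defensive.

Definition log2 (x : R) : R := (ln x / ln 2)%R.

Definition simple_graph (T : finType) (e : rel T) : Prop :=
  symmetric e /\ irreflexive e.

Definition is_clique (T : finType) (e : rel T) (S : {set T}) : Prop :=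
  forall x y, x \in S -> y \in S -> x != y -> e x y.

Definition is_indep (T : finType) (e : rel T) (S : {set T}) : Prop :=
  forall x y, x \in S -> y \in S -> x != y -> ~~ e x y.

Definition locally_ramsey (T : finType) (e : rel T) (m r : R) : Prop :=
  forall S : {set T}, (m <= INR #|S|)%R ->
    (exists C : {set T}, C \subset S /\ is_clique e C /\ (r <= INR #|C|)%R) /\
    (exists I : {set T}, I \subset S /\ is_indep e I /\ (r <= INR #|I|)%R).

(* Main.v *)
(** Call a graph s-mixed if every set of s vertices spans both an edge and a
    non-edge.

    If G is s-mixed and (m, R)-locally Ramsey, its l-th lexicographic power is
    (s^l m^b, min(2^b, R))-locally Ramsey: a vertex set of that size, viewed as a
    tree of depth l, either branches m times somewhere or branches at least s times
    on b levels, each of which doubles the clique.  Powers contain homogeneous sets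
    exponential in l, so they are not s-mixed for small s.

    Noise restores mixedness: each pair becomes an edge, respectively a non-edge,
    with probability 1/(2R^2), and is left alone otherwise.  With
    D = 2R^2 (log n + 3), a set of M = 2m(D+1) vertices contains, by a greedy Turan
    argument, more than M log n edge-disjoint R-cliques of the old graph.  Each
    survives with probability at least 1/2, so a union bound over all M-sets shows
    that the local Ramsey property survives as well.

    Take R = 2^a and l = k, with k about (log N)^(1/t) and a about log r, and let
    the j-th graph have 2^(k^j) vertices; each round multiplies log m by a, up to
    an additive term O(k a). *)

Require Import Defs.
From mathcomp Require Import all_boot zify.

Set Implicit Arguments.
Unset Strict Implicit.
Unset Printing Implicit Defensive.

(** * Lexicographic powers *)

Lemma exists_subset_card (T : finType) (S : {set T}) (k : nat) :
  k <= #|S| -> exists2 A : {set T}, A \subset S & #|A| = k.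
Proof.
case/card_geqP => s [us <- sS]; exists [set x in s].
  by apply/subsetP => x; rewrite inE => /sS.
by rewrite cardsE; apply/card_uniqP.
Qed.

Lemma is_clique_sub (T : finType) (e : rel T) (A B : {set T}) :
  A \subset B -> is_clique e B -> is_clique e A.
Proof. by move=> /subsetP sAB cB x y /sAB xB /sAB yB; apply: cB. Qed.

Lemma is_clique_ext (T : finType) (e f : rel T) (C : {set T}) :
  (forall x y, x != y -> e x y = f x y) -> is_clique e C -> is_clique f C.
Proof. by move=> ef cC x y xC yC xy; rewrite -ef //; apply: cC. Qed.

Definition forces_edge (T : finType) (e : rel T) (s : nat) : Prop :=
  forall S : {set T}, s <= #|S| ->
    exists x y, [/\ x \in S, y \in S, x != y & e x y].

Definition forces_clique (T : finType) (e : rel T) (m R : nat) : Prop :=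
  forall S : {set T}, m <= #|S| ->
    exists C : {set T}, [/\ C \subset S, is_clique e C & R <= #|C|].

(** True on the diagonal when [e] is irreflexive, which is harmless because cliques and edges only
    concern distinct vertices. A clique statement for [compl e] is one about independent sets of
    [e], so each argument is made once. *)
Definition compl (T : finType) (e : rel T) : rel T := fun x y => ~~ e x y.

Lemma forces_clique_ext (T : finType) (e f : rel T) m R :
  (forall x y, x != y -> e x y = f x y) ->
  forces_clique e m R -> forces_clique f m R.
Proof.
move=> ef He S /He[C [CS cC RC]]; exists C; split=> //.
exact: is_clique_ext ef cC.
Qed.

Lemma forces_edge_leq (T : finType) (e : rel T) s s' :
  s <= s' -> forces_edge e s -> forces_edge e s'.
Proof. by move=> ss' He S s'S; apply: He; apply: leq_trans s'S. Qed.

Lemma forces_clique_leq (T : finType) (e : rel T) m m' R :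
  m <= m' -> forces_clique e m R -> forces_clique e m' R.
Proof. by move=> ss' He S s'S; apply: He; apply: leq_trans s'S. Qed.

Definition lex (T U : finType) (e : rel T) (f : rel U) : rel (T * U) :=
  fun p q => if p.1 == q.1 then f p.2 q.2 else e p.1 q.1.

Lemma lex_simple (T U : finType) (e : rel T) (f : rel U) :
  simple_graph e -> simple_graph f -> simple_graph (lex e f).
Proof.
move=> [se ie] [sf jf]; split=> [[x u] [y v]|[x u]]; rewrite /lex /=.
  by rewrite eq_sym se sf.
by rewrite eqxx jf.
Qed.

Lemma compl_lex (T U : finType) (e : rel T) (f : rel U) p q :
  compl (lex e f) p q = lex (compl e) (compl f) p q.
Proof. by rewrite /compl /lex; case: ifP. Qed.

Lemma compl_sym (T : finType) (e : rel T) : symmetric e -> symmetric (compl e).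
Proof. by move=> se x y; rewrite /compl se. Qed.

Section Fibre.
Variables (T U : finType).
Implicit Types (S : {set T * U}) (x : T).

Definition fibre S x : {set U} := [set u | (x, u) \in S].

Lemma card_fibres S : #|S| = \sum_x #|fibre S x|.
Proof.
rewrite -sum1_card (partition_big fst predT) //=; apply: eq_bigr => x _.
rewrite -sum1_card (reindex_onto (fun u => (x, u)) snd) /=.
  by apply: eq_bigl => u; rewrite !inE !eqxx !andbT.
by case=> y u /andP[_ /eqP /= ->].
Qed.

Lemma fibre_clique (e : rel T) (f : rel U) S x (C : {set U}) :
  C \subset fibre S x -> is_clique f C ->
  pair x @: C \subset S /\ is_clique (lex e f) (pair x @: C).
Proof.
move=> /subsetP CS cC; split.
  by apply/subsetP => _ /imsetP[u /CS + ->]; rewrite inE.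
move=> _ _ /imsetP[u uC ->] /imsetP[v vC ->].
rewrite xpair_eqE eqxx /lex eqxx /=; exact: cC.
Qed.

Lemma card_pair_imset x (C : {set U}) : #|pair x @: C| = #|C|.
Proof. by apply: card_imset => u v []. Qed.

Lemma lex_base_clique (e : rel T) (f : rel U) S (C : {set T}) :
  is_clique e C -> (forall x, x \in C -> fibre S x != set0) ->
  exists D : {set T * U}, [/\ D \subset S, is_clique (lex e f) D & #|D| = #|C|].
Proof.
move=> cC neC.
case: (pickP (mem C)) => [x0 x0C|C0]; last first.
  exists set0; rewrite sub0set cards0 (eq_card0 C0); split=> // p q.
  by rewrite inE.
have [u0 _] := set0Pn _ (neC _ x0C).
(* [u0] is the default that makes [g] total; an empty [C] would not provide it, hence the separate
   case above. *)
pose g x := odflt u0 [pick u in fibre S x].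
have gP x : x \in C -> (x, g x) \in S.
  move=> /neC /set0Pn[u uS]; rewrite /g; case: pickP => [v|/(_ u)] /=.
    by rewrite inE.
  by rewrite uS.
exists [set (x, g x) | x in C]; split.
- by apply/subsetP => _ /imsetP[x /gP + ->].
- move=> _ _ /imsetP[x xC ->] /imsetP[y yC ->].
  rewrite /lex /=; case: (eqVneq x y) => [->|xy _]; first by rewrite eqxx.
  exact: cC.
- by apply: card_imset => x y [].
Qed.

Lemma lex_union_clique (e : rel T) (f : rel U) S x y (C D : {set U}) :
  symmetric e -> x != y -> e x y ->
  C \subset fibre S x -> is_clique f C -> D \subset fibre S y -> is_clique f D ->
  exists E : {set T * U},
    [/\ E \subset S, is_clique (lex e f) E & #|E| = #|C| + #|D|].
Proof.
move=> se xy exy CS cC DS cD.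
have [CS' cC'] := fibre_clique e CS cC.
have [DS' cD'] := fibre_clique e DS cD.
exists (pair x @: C :|: pair y @: D); split.
- by rewrite subUset CS'.
- move=> p q; rewrite !inE => /orP[pC|pD] /orP[qC|qD] pq.
  + exact: cC'.
  + case/imsetP: pC => u _ ->; case/imsetP: qD => v _ ->.
    by rewrite /lex /= (negPf xy).
  + case/imsetP: pD => u _ ->; case/imsetP: qC => v _ ->.
    by rewrite /lex /= eq_sym (negPf xy) se.
  + exact: cD'.
- rewrite cardsU !card_pair_imset disjoint_setI0 ?cards0 ?subn0 //.
  apply/pred0P => -[z u] /=; apply/negP => /andP[/imsetP[v _ [-> _]]].
  by case/imsetP => w _ [/eqP]; rewrite (negPf xy).
Qed.

End Fibre.

(* Either one fibre alone is large enough for the induction on l, or s fibres are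
   large (an edge of e then doubles the clique), or m fibres are nonempty (a clique
   of e lifts); otherwise S is too small. *)
Lemma lex_forces_clique (T U : finType) (e : rel T) (f : rel U) m R s g :
  symmetric e -> 0 < s -> 0 < g -> 1 < m -> forces_clique e m R -> forces_edge e s ->
  (forall b, forces_clique f (g * m ^ b) (minn (2 ^ b) R)) ->
  forall b, forces_clique (lex e f) (s * g * m ^ b) (minn (2 ^ b) R).
Proof.
(* For [b = 0] a single vertex suffices, since 2^0 = 1. *)
move=> se s0 g0 m1 He Hs Hf [|b] S leS.
  have /card_gt0P[p pS] : 0 < #|S| by apply: leq_trans leS; rewrite !muln_gt0 s0 g0.
  exists [set p]; rewrite sub1set cards1 geq_minl; split=> // x y.
  by rewrite !inE => /eqP-> /eqP->; rewrite eqxx.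
pose big := g * m ^ b.+1; pose mid := g * m ^ b.
case: (pickP (fun x => big <= #|fibre S x|)) => [x xb|small].
  have [C [CS cC RC]] := Hf _ _ xb.
  have [CS' cC'] := fibre_clique e CS cC.
  by exists (pair x @: C); rewrite card_pair_imset.
pose B := [set x | mid <= #|fibre S x|].
pose A := [set x | fibre S x != set0].
have [sB|Bs] := leqP s #|B|.
  have [x [y [xB yB xy exy]]] := Hs _ sB.
  move: xB yB; rewrite !inE => xB yB.
  have [C [CS cC RC]] := Hf _ _ xB; have [D [DS cD RD]] := Hf _ _ yB.
  have [E [ES cE cardE]] := lex_union_clique se xy exy CS cC DS cD.
  (* Uses 2 min(2^b, R) >= min(2^(b+1), R). *)
  exists E; split=> //; rewrite cardE expnS; lia.
have [mA|Am] := leqP m #|A|.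
  have [C [CA cC RC]] := He _ mA.
  have neC x : x \in C -> fibre S x != set0.
    by move/(subsetP CA); rewrite inE.
  have [D [DS cD cardD]] := lex_base_clique f cC neC.
  by exists D; rewrite cardD; split=> //; apply: leq_trans RC; apply: geq_minr.
suff : #|S| < s * g * m ^ b.+1 by rewrite ltnNge leS.
have m0 : 0 < mid by rewrite muln_gt0 g0 expn_gt0 (ltnW m1).
have bE : big = m * mid by rewrite /big /mid expnS mulnCA.
(* Fibres over [B] stay below [big], other nonempty ones below [mid]. As |B| <= s - 1 and |A| mid <
   m mid = big, the total is below s big. *)
have cS : #|S| <= #|B| * big + #|A| * mid.
  rewrite card_fibres -!sum_nat_const.
  rewrite (bigID (mem B)) /= leq_add //.
    by apply: leq_sum => x _; rewrite ltnW // ltnNge small.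
  rewrite (bigID (mem A)) /= [X in _ + X]big1 ?addn0; last first.
    by move=> x /andP[_]; rewrite inE negbK => /eqP->; rewrite cards0.
  rewrite big_mkcondl /=; apply: leq_sum => x _; case: ifP => //.
  by rewrite inE -ltnNge => /ltnW.
apply: leq_ltn_trans cS _; rewrite -mulnA -/big.
have : #|A| * mid < big by rewrite bE ltn_mul2r m0.
have : #|B|.+1 * big <= s * big by rewrite leq_mul2r Bs orbT.
rewrite mulSn; lia.
Qed.

Lemma lex_power (T : finType) (e : rel T) m R s l :
  simple_graph e -> 0 < s -> 1 < m ->
  forces_clique e m R -> forces_clique (compl e) m R ->
  forces_edge e s -> forces_edge (compl e) s ->
  exists (U : finType) (f : rel U), [/\ simple_graph f, #|U| = #|T| ^ l,
    forall b, forces_clique f (s ^ l * m ^ b) (minn (2 ^ b) R) &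
    forall b, forces_clique (compl f) (s ^ l * m ^ b) (minn (2 ^ b) R)].
Proof.
move=> ge s0 m1 Hc Hi Ec Ei; have [se _] := ge.
elim: l => [|l [U [f [gf cardU Fc Fi]]]].
  (* On one vertex, [b = 0] asks for a clique of at most one vertex; for larger [b] the threshold
     exceeds 1 and the claim is vacuous. *)
  have H (h : rel unit) b : forces_clique h (s ^ 0 * m ^ b) (minn (2 ^ b) R).
    move=> S; rewrite mul1n; case: b => [|b] leS.
      exists S; split=> //.
      by apply: (leq_trans _ leS); rewrite !expn0 geq_minl.
    have := leq_trans leS (max_card _); rewrite card_unit expnS.
    have : 0 < m ^ b by rewrite expn_gt0 (ltnW m1).
    nia.
  by exists unit, (fun _ _ => false); split=> //; rewrite card_unit.
exists (T * U)%type, (lex e f); rewrite card_prod cardU expnS; split=> //.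
- exact: lex_simple.
- by move=> b; rewrite expnS; apply: lex_forces_clique => //; rewrite expn_gt0 s0.
- move=> b; rewrite expnS.
  apply: (forces_clique_ext (e := lex (compl e) (compl f))) => [p q _|].
    by rewrite compl_lex.
  by apply: lex_forces_clique => //; [apply: compl_sym | rewrite expn_gt0 s0].
Qed.

(** * Edge-disjoint cliques, independence and noise *)

Lemma card_bigcup_leq (J T : finType) (X : {set J}) (F : J -> {set T}) :
  #|\bigcup_(i in X) F i| <= \sum_(i in X) #|F i|.
Proof.
apply: (big_ind2 (fun (Y : {set T}) n => #|Y| <= n)) => [|Y a Z b Ya Zb|//].
  by rewrite cards0.
apply: leq_trans (leq_add Ya Zb); exact: leq_card_setU.
Qed.

(** The reserve of [B] vertices in [S] prevents all degrees from exceeding [d], as there are only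
    [d * B] ordered pairs. Taking a vertex of degree at most [d] and deleting it with its neighbours
    costs at most d + 1 vertices. *)
Lemma greedy_independent (T : finType) (P : rel T) (B d m : nat) (S : {set T}) :
  symmetric P -> #|[set p : T * T | P p.1 p.2]| <= d * B ->
  B + m * d.+1 <= #|S| ->
  exists I : {set T}, [/\ I \subset S, #|I| = m &
    forall x y, x \in I -> y \in I -> x != y -> ~~ P x y].
Proof.
move=> sP leP; elim: m S => [|m IH] S leS.
  exists set0; rewrite sub0set cards0; split=> // x y; by rewrite inE.
have [v vS degv] : exists2 v, v \in S & #|[set y | P v y]| <= d.
  apply/exists_inP; apply: contraT; rewrite negb_exists_in => /forall_inP degS.
  have : #|S| * d.+1 <= #|[set p : T * T | P p.1 p.2]|.
    rewrite card_fibres -sum_nat_const [leqRHS](bigID (mem S)) /=.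
    apply: leq_trans (leq_addr _ _); apply: leq_sum => v vS.
    rewrite ltnNge; apply: contra (degS v vS); congr (_ <= _).
    by apply: eq_card => y; rewrite !inE.
  nia.
pose S' := S :\: (v |: [set y | P v y]).
have cS' : B + m * d.+1 <= #|S'|.
  have := cardsID (v |: [set y | P v y]) S; rewrite -/S'.
  have := subset_leq_card (subsetIr S (v |: [set y | P v y])).
  have := cardsU1 v [set y | P v y].
  have : (v \notin [set y | P v y]) <= 1 by case: (v \notin _).
  lia.
have [I [IS' cI indI]] := IH _ cS'.
have notP y : y \in I -> (y != v) && ~~ P v y.
  by move/(subsetP IS'); rewrite !inE negb_or => /andP[].
exists (v |: I); split.
- rewrite subUset sub1set vS /=; apply: subset_trans IS' _; exact: subsetDl.
- rewrite cardsU1 cI; case vI: (v \in I) => //.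
  by have := notP _ vI; rewrite eqxx.
- move=> x y; rewrite !inE => /orP[/eqP->|xI] /orP[/eqP->|yI] xy.
  + by rewrite eqxx in xy.
  + by have /andP[] := notP _ yI.
  + by rewrite sP; have /andP[] := notP _ xI.
  + exact: indI.
Qed.

Definition pairs (T : finType) (Q : {set T}) : {set {set T}} :=
  [set A : {set T} | A \subset Q & #|A| == 2].

Lemma in_pairs (T : finType) (Q : {set T}) x y :
  x \in Q -> y \in Q -> x != y -> [set x; y] \in pairs Q.
Proof. by move=> xQ yQ xy; rewrite inE subUset !sub1set xQ yQ cards2 xy. Qed.

Lemma pairsP (T : finType) (Q A : {set T}) :
  reflect (exists x y, [/\ x \in Q, y \in Q, x != y & A = [set x; y]])
          (A \in pairs Q).
Proof.
apply: (iffP idP) => [|[x [y [xQ yQ xy ->]]]]; last exact: in_pairs.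
rewrite inE => /andP[AQ /cards2P[x [y [xy AE]]]]; exists x, y.
by move: AQ; rewrite AE subUset !sub1set => /andP[].
Qed.

(** Call two vertices in conflict ([P]) if an earlier clique contains both. A conflict-free set of
    [m] vertices contains a further R-clique, which meets each earlier one in at most one vertex.
    The j cliques create at most j R^2 ordered conflicts. *)
Lemma edge_disjoint_cliques (T : finType) (e : rel T) m R D j (S : {set T}) :
  1 < R -> forces_clique e m R -> 2 * m * D.+1 <= #|S| ->
  j * R ^ 2 <= D * (m * D.+1) ->
  exists QQ : {set {set T}}, [/\ #|QQ| = j,
    forall Q, Q \in QQ -> [/\ Q \subset S, is_clique e Q & #|Q| = R] &
    forall Q Q', Q \in QQ -> Q' \in QQ -> Q != Q' ->
      [disjoint pairs Q & pairs Q']].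
Proof.
move=> R1 He leS; elim: j => [|j IH] lej.
  by exists set0; rewrite cards0; split=> // Q; rewrite inE.
have lej' : j * R ^ 2 <= D * (m * D.+1) by rewrite mulSn in lej; lia.
have [QQ [cQQ cliqueQQ disjQQ]] := IH lej'.
pose P x y := [exists Q in QQ, (x \in Q) && (y \in Q)].
have sP : symmetric P.
  by move=> x y; apply: eq_existsb => Q; rewrite [(x \in _) && _]andbC.
have cP : #|[set p : T * T | P p.1 p.2]| <= D * (m * D.+1).
  apply: leq_trans lej'; rewrite -cQQ -sum_nat_const.
  apply: leq_trans (_ : #|\bigcup_(Q in QQ) setX Q Q| <= _).
    apply/subset_leq_card/subsetP => p; rewrite inE => /exists_inP[Q QQ' pQ].
    by apply/bigcupP; exists Q; rewrite // inE.
  apply: leq_trans (card_bigcup_leq _ _) _; apply: leq_sum => Q QQ'.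
  by have [_ _ cQ] := cliqueQQ _ QQ'; rewrite cardsX cQ mulnn.
have [I [IS cI indI]] : exists I : {set T}, [/\ I \subset S, #|I| = m &
    forall x y, x \in I -> y \in I -> x != y -> ~~ P x y].
  (* Here d = D and B = m (D + 1), so B + m (D + 1) is the assumed size of [S]. *)
  by apply: greedy_independent sP cP _; apply: leq_trans leS; lia.
have [C [CI cC RC]] := He I (eq_leq (esym cI)).
have [Q QC cQ] := exists_subset_card RC.
have QI := subset_trans QC CI.
have newQ Q' : Q' \in QQ -> [disjoint pairs Q & pairs Q'].
  move=> Q'QQ; apply/pred0P => A; apply/negP => /= /andP[].
  case/pairsP => x [y [xQ yQ xy ->]]; rewrite inE subUset !sub1set.
  case/andP => xyQ' _; have := indI x y (subsetP QI _ xQ) (subsetP QI _ yQ) xy.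
  by case/exists_inP; exists Q'.
(* As R > 1, [Q] has a pair, and so cannot be edge-disjoint from itself. *)
have QnQQ : Q \notin QQ.
  apply/negP => /newQ; have /card_gt1P[x [y [xQ yQ xy]]] : 1 < #|Q| by rewrite cQ.
  by move/pred0P/(_ [set x; y]); rewrite /= !in_pairs.
exists (Q |: QQ); split; first by rewrite cardsU1 QnQQ cQQ.
- move=> Q'; rewrite !inE => /orP[/eqP->|/cliqueQQ//]; split=> //.
    exact: subset_trans IS.
  exact: is_clique_sub cC.
- move=> Q1 Q2; rewrite !inE => /orP[/eqP->|Q1Q] /orP[/eqP->|Q2Q] ne.
  + by rewrite eqxx in ne.
  + exact: newQ.
  + by rewrite disjoint_sym; apply: newQ.
  + exact: disjQQ.
Qed.

(** * Independence by counting in a finite product space *)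

Section Independence.
Variables (I A : finType).
Local Notation Omega := {ffun I -> A}.

Definition depends_on (D : {set I}) (P : pred Omega) : Prop :=
  forall w w' : Omega, {in D, w =1 w'} -> P w = P w'.

(* Swapping the coordinates in D of two independent samples is an involution
   that carries the event P(w) and Q(w') to (P and Q)(w). *)
Lemma card_independent (D : {set I}) (P Q : pred Omega) :
  depends_on D P -> depends_on (~: D) Q ->
  #|[set w | P w && Q w]| * #|Omega| = #|[set w | P w]| * #|[set w | Q w]|.
Proof.
move=> DP DQ.
pose mix (w w' : Omega) : Omega := [ffun i => if i \in D then w i else w' i].
pose swap (p : Omega * Omega) := (mix p.1 p.2, mix p.2 p.1).
have swapK : involutive swap.
  case=> w w'; congr (_, _); apply/ffunP => i; rewrite !ffunE /=; by case: (i \in D).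
have -> : #|Omega| = #|[set: Omega]| by rewrite cardsT.
rewrite -!cardsX -(card_preimset _ (inv_inj swapK)).
apply: eq_card => -[w w']; rewrite !inE /= andbT; congr (_ && _).
  by apply: DP => i iD; rewrite ffunE iD.
by apply: DQ => i; rewrite inE ffunE => /negPf->.
Qed.

(** Product rule for independent events of probability at most a/b, with denominators cleared. Peel
    off one event: the others depend only on coordinates outside [D i]. *)
Lemma card_all_independent (J : eqType) (r : seq J) (D : J -> {set I})
    (P : J -> pred Omega) (a b : nat) :
  uniq r -> {in r, forall i, depends_on (D i) (P i)} ->
  {in r &, forall i j, i != j -> [disjoint D i & D j]} ->
  {in r, forall i, #|[set w | P i w]| * b <= a * #|Omega|} ->
  #|[set w | all (P^~ w) r]| * b ^ size r <= a ^ size r * #|Omega|.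
Proof.
elim: r => [|i r IH] /=; first by rewrite !muln1 mul1n max_card.
case/andP => ir ur Dr disjr leP.
have sub j : j \in r -> j \in i :: r by rewrite inE orbC => ->.
have i_in : i \in i :: r by rewrite inE eqxx.
have {}IH : #|[set w | all (P^~ w) r]| * b ^ size r <= a ^ size r * #|Omega|.
  apply: IH => // [j /sub|j k /sub jr /sub kr|j /sub]; auto.
(* One factor [#|Omega|] is cancelled below, so an empty space is treated first. *)
have [O0|Opos] := posnP #|Omega|.
  have := max_card [set w | P i w && all (P^~ w) r]; rewrite O0.
  by rewrite leqn0 => /eqP->.
rewrite -(leq_pmul2r Opos) mulnAC (card_independent (D := D i)) //; first last.
- move=> w w' ww'; apply: eq_in_all => j jr; apply: (Dr _ (sub _ jr)) => k kj.
  apply: ww'; rewrite inE; apply/negP => ki.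
  have ij : i != j by apply: contraNneq ir => ->.
  by have /pred0P/(_ k) := disjr _ _ i_in (sub _ jr) ij; rewrite /= ki kj.
- exact: Dr.
have := leq_mul (leP _ i_in) IH; rewrite !expnS.
by rewrite mulnACA (mulnACA a) !mulnA.
Qed.

Lemma card_coordinate (i : I) (X : {set A}) :
  #|[set w : Omega | w i \in X]| * #|A| = #|X| * #|Omega|.
Proof.
pose F j := if j == i then mem X else mem A.
have -> : #|[set w : Omega | w i \in X]| = #|family F|.
  apply: eq_card => w; rewrite !inE; apply/idP/familyP => [wX j|/(_ i)].
    by rewrite /F; case: eqP => [->|].
  by rewrite /F eqxx.
rewrite card_family foldrE big_map big_enum /= (bigD1 i) //= {1}/F eqxx.
rewrite card_ffun -prod_nat_const [in RHS](bigD1 i) //=.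
rewrite -mulnA [_ * #|A|]mulnC; congr (_ * (_ * _)).
by apply: eq_bigr => j /negPf ji; rewrite /F ji.
Qed.

End Independence.

(** * Numerical estimates and the union bound *)

Lemma leq_expn2r m n e : m <= n -> m ^ e <= n ^ e.
Proof. by case: e => // e; rewrite leq_exp2r. Qed.

Lemma bin_leq_expn n k : 'C(n, k) <= n ^ k.
Proof.
apply: leq_trans (_ : n ^_ k <= _); first by rewrite -bin_ffact leq_pmulr ?fact_gt0.
rewrite ffact_prod -[X in n ^ X]card_ord -prod_nat_const.
by apply: leq_prod => i _; apply: leq_subr.
Qed.

(** This is (1 - 1/K)^K <= 1/2, from Bernoulli's inequality for (1 + 1/k)^(k+1) with k = K - 1. *)
Lemma expn_pred_double K : 0 < K -> 2 * K.-1 ^ K <= K ^ K.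
Proof.
case: K => // k _ /=.
have bernoulli n : k ^ n.+1 + n.+1 * k ^ n <= k.+1 ^ n.+1.
  elim: n => [|n IH]; first by rewrite !expn1 expn0 muln1 addn1.
  rewrite [k.+1 ^ n.+2]expnS; apply: leq_trans (leq_mul (leqnn _) IH).
  rewrite !expnS; nia.
apply: leq_trans (bernoulli k); rewrite mul2n -addnn leq_add2l expnS leq_mul2r.
by rewrite leqnSn orbT.
Qed.

(** Union bound over at most 2^(L s) sets; the spare 2^3 leaves each kind of bad event with
    probability at most 1/8. *)
Lemma card_union_small (T Om : finType) (L s : nat) (E : {set T} -> {set Om}) :
  #|T| <= 2 ^ L -> (forall S : {set T}, #|S| = s -> #|E S| * 2 ^ (L * s + 3) <= #|Om|) ->
  #|\bigcup_(S in [set S : {set T} | #|S| == s]) E S| * 8 <= #|Om|.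
Proof.
move=> leT leE; set U := \bigcup_(S in _) _.
have : #|U| * 2 ^ (L * s + 3) <= 2 ^ (L * s) * #|Om|.
  apply: leq_trans (_ : 'C(#|T|, s) * #|Om| <= _).
    rewrite -card_draws -[leqRHS]sum_nat_const.
    apply: leq_trans (leq_mul (card_bigcup_leq _ _) (leqnn _)) _.
    rewrite big_distrl; apply: leq_sum => S; rewrite inE => /eqP; exact: leE.
  apply: leq_mul => //; apply: leq_trans (bin_leq_expn _ _) _; rewrite expnM.
  exact: leq_expn2r.
by rewrite expnD mulnCA leq_pmul2l // expn_gt0.
Qed.

(** * Random noise on a graph *)

Section Noise.
Variables (T A : finType).
Local Notation Omega := {ffun {set T} -> A}.
Implicit Types (S Q : {set T}) (w : Omega).

(** [w] colours vertex sets, which makes the colour of a pair symmetric. Colour [c0] creates an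
    edge, [c1] a non-edge, any other colour keeps [e]; for uniform [w] each of the two has
    probability 1/|A|. *)
Definition noise (c0 c1 : A) (e : rel T) (w : Omega) : rel T := fun x y =>
  (x != y) && ((w [set x; y] == c0) || (w [set x; y] != c1) && e x y).

Lemma noise_simple c0 c1 e w : symmetric e -> simple_graph (noise c0 c1 e w).
Proof.
move=> se; split=> [x y|x]; last by rewrite /noise eqxx.
by rewrite /noise eq_sym setUC se.
Qed.

(** Exchanging the two colours transfers all clique estimates to independent sets. *)
Lemma compl_noise c0 c1 e w x y : c0 != c1 -> x != y ->
  noise c1 c0 (compl e) w x y = compl (noise c0 c1 e w) x y.
Proof.
move=> c01 xy; rewrite /compl /noise xy /=.
case: (eqVneq (w _) c0) => [->|_] /=; first by rewrite (negPf c01).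
by case: eqP.
Qed.

(** Bad event for mixedness: noise creates no edge ([c = c0]) or no non-edge ([c = c1]) in [S]. What
    [e] contributes is ignored, so the event does not depend on [e]. *)
Definition no_edge (c : A) (S : {set T}) : {set Omega} :=
  [set w : Omega | all (fun p => w p != c) (enum (pairs S))].

Definition cliqueb (e : rel T) (Q : {set T}) :=
  [forall x in Q, forall y in Q, (x != y) ==> e x y].

Lemma cliqueP e Q : reflect (is_clique e Q) (cliqueb e Q).
Proof.
apply: (iffP forall_inP) => [H x y xQ yQ xy|H x xQ].
  by have /forall_inP/(_ y yQ)/implyP := H x xQ; apply.
by apply/forall_inP => y yQ; apply/implyP; apply: H.
Qed.

Definition no_clique (c0 c1 : A) (e : rel T) (R : nat) (S : {set T}) : {set Omega} :=
  [set w : Omega | ~~ [exists Q : {set T},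
     [&& Q \subset S, cliqueb (noise c0 c1 e w) Q & R <= #|Q|]]].

(** Each pair avoids [c] with probability 1 - 1/K. Over |S| D = K |S| (L + 3) pairs this gives at
    most 2^(-|S| (L + 3)). *)
Lemma card_no_edge c S L D : 1 < #|A| -> D = #|A| * (L + 3) ->
  #|S| = 2 * D + 1 -> #|no_edge c S| * 2 ^ (L * #|S| + 3) <= #|Omega|.
Proof.
move=> K1 DE cS; set K := #|A| in K1 DE.
have K0 := ltnW K1.
have H : #|no_edge c S| * K ^ (#|S| * D) <= K.-1 ^ (#|S| * D) * #|Omega|.
  (* The size 2D + 1 makes the number of pairs exactly |S| D. *)
  have -> : #|S| * D = size (enum (pairs S)).
    by rewrite -cardE /pairs cards_draws bin2 cS addn1 /=; nia.
  apply: (card_all_independent (D := fun p => [set p])).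
  - exact: enum_uniq.
  - by move=> p _ w w' -> //; rewrite inE.
  - by move=> p q _ _ pq; rewrite disjoints1 inE.
  - move=> p _; have := card_coordinate p [set~ c].
    rewrite cardsC1 => <-; rewrite leq_mul2r subset_leq_card ?orbT //.
    by apply/subsetP => w; rewrite !inE.
have K2 : 2 ^ (L * #|S| + 3) * K.-1 ^ (#|S| * D) <= K ^ (#|S| * D).
  apply: leq_trans (_ : 2 ^ (#|S| * (L + 3)) * K.-1 ^ (#|S| * D) <= _).
    rewrite leq_mul2r leq_exp2l // orbC; apply/orP; left; rewrite cS; nia.
  have -> : #|S| * D = K * (#|S| * (L + 3)) by rewrite DE; lia.
  rewrite [K ^ _]expnM [_.-1 ^ _]expnM -expnMn.
  by apply: leq_expn2r; apply: expn_pred_double.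
have Kn : 0 < K.-1 ^ (#|S| * D) by rewrite expn_gt0 -subn1 subn_gt0 K1.
rewrite -(leq_pmul2r Kn) -mulnA [#|Omega| * _]mulnC.
by apply: leq_trans H; rewrite leq_mul2l K2 orbT.
Qed.

(** An old clique with no pair coloured [c0] or [c1] survives. The event thus requires all of [j]
    edge-disjoint cliques to be hit, which are independent events of probability at most 1/2. *)
Lemma card_no_clique c0 c1 e m R L D S : 1 < R -> #|A| = 2 * R ^ 2 -> 0 < m ->
  D = #|A| * (L + 3) -> forces_clique e m R -> #|S| = 2 * m * D.+1 ->
  #|no_clique c0 c1 e R S| * 2 ^ (L * #|S| + 3) <= #|Omega|.
Proof.
move=> R1 cA m0 DE He cS; set j := L * #|S| + 3.
(* Since m (D + 1) = |S|/2 and D = 2R^2 (L + 3), the right side is R^2 (L + 3) |S|. *)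
have lej : j * R ^ 2 <= D * (m * D.+1).
  have : 0 < #|S| by rewrite cS !muln_gt0 m0.
  have : D * (m * D.+1) = R ^ 2 * (L + 3) * #|S| by rewrite cS DE cA; lia.
  move=> -> M0; rewrite /j mulnC -mulnA leq_mul2l; apply/orP; right; nia.
have [QQ [cQQ cliqueQQ disjQQ]] := edge_disjoint_cliques R1 He (eq_leq (esym cS)) lej.
pose hit Q (w : Omega) := [exists p in pairs Q, w p \in [set c0; c1]].
apply: leq_trans (_ : #|[set w : Omega | all (hit^~ w) (enum QQ)]| * 2 ^ j <= _).
  rewrite leq_mul2r subset_leq_card ?orbT //; apply/subsetP => w.
  rewrite !inE; apply: contraR => /allPn[Q]; rewrite mem_enum => QQQ.
  have [QS cQ sQ] := cliqueQQ _ QQQ.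
  rewrite negb_exists_in => /forall_inP nohit; apply/existsP; exists Q.
  rewrite QS sQ leqnn andbT; apply/cliqueP => x y xQ yQ xy.
  have := nohit _ (in_pairs xQ yQ xy); rewrite !inE negb_or => /andP[_ w1].
  by rewrite /noise xy w1 cQ // orbT.
rewrite -cQQ [#|QQ|]cardE.
suff : #|[set w | all (hit^~ w) (enum QQ)]| * 2 ^ size (enum QQ) <=
       1 ^ size (enum QQ) * #|Omega| by rewrite exp1n mul1n.
apply: (card_all_independent (D := @pairs T) ).
- exact: enum_uniq.
- move=> Q _ w w' ww'; apply: eq_existsb => p.
  by case pQ: (p \in pairs Q); rewrite //= ww'.
- by move=> Q Q'; rewrite !mem_enum; apply: disjQQ.
(* At most R^2/2 pairs, each hit with probability at most 2/(2R^2), so a clique is hit with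
   probability at most 1/2. *)
- move=> Q; rewrite mem_enum => /cliqueQQ[_ _ cQ].
  have R2 : 0 < R ^ 2 by rewrite expn_gt0 ltnW.
  rewrite -(leq_pmul2r R2) -[leqLHS]mulnA -cA.
  apply: leq_trans (_ : (\sum_(p in pairs Q)
      #|[set w : Omega | w p \in [set c0; c1]]|) * #|A| <= _).
    rewrite leq_mul2r; apply/orP; right.
    apply: leq_trans (card_bigcup_leq _ _); apply: subset_leq_card.
    apply/subsetP => w; rewrite inE => /exists_inP[p pQ wp].
    by apply/bigcupP; exists p; rewrite // inE.
  rewrite big_distrl /=.
  rewrite (eq_bigr (fun _ => #|[set c0; c1]| * #|Omega|)) => [|p _]; last first.
    exact: card_coordinate.
  rewrite sum_nat_const /pairs cards_draws cQ bin2 mul1n cards2 mulnA mulnC leq_mul2l.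
  apply/orP; right; have : R * R.-1 <= R ^ 2 by rewrite -mulnn leq_mul2l leq_pred orbT.
  by case: (c0 != c1); lia.
Qed.
End Noise.

(** Four kinds of bad event, each of probability at most 1/8, leave a good sample. *)
Lemma noise_exists (T : finType) (e : rel T) (m R L D : nat) :
  symmetric e -> 1 < R -> 0 < m -> #|T| <= 2 ^ L -> D = 2 * R ^ 2 * (L + 3) ->
  forces_clique e m R -> forces_clique (compl e) m R ->
  exists f : rel T, [/\ simple_graph f,
    forces_clique f (2 * m * D.+1) R, forces_clique (compl f) (2 * m * D.+1) R,
    forces_edge f (2 * D + 1) & forces_edge (compl f) (2 * D + 1)].
Proof.
move=> se R1 m0 leT DE Hc Hi.
(* The form with two successors gives the colour type the elements [ord0] and [ord_max], visibly
   distinct. *)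
have KE : (2 * R ^ 2).-2.+2 = 2 * R ^ 2.
  by have : 0 < R ^ 2 by [rewrite expn_gt0 ltnW]; lia.
pose A := 'I_(2 * R ^ 2).-2.+2.
have cA : #|A| = 2 * R ^ 2 by rewrite card_ord.
have DE' : D = #|A| * (L + 3) by rewrite cA.
have A1 : 1 < #|A| by rewrite card_ord.
pose c0 : A := ord0; pose c1 : A := ord_max.
have c01 : c0 != c1 by [].
pose s := 2 * D + 1; pose M := 2 * m * D.+1.
pose bigs k E : {set {ffun {set T} -> A}} :=
  \bigcup_(S in [set S : {set T} | #|S| == k]) E S.
have b0 : #|bigs s (no_edge c0)| * 8 <= #|{ffun {set T} -> A}|.
  by apply: card_union_small leT _ => S cS; rewrite -cS; apply: card_no_edge DE' cS.
have b1 : #|bigs s (no_edge c1)| * 8 <= #|{ffun {set T} -> A}|.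
  by apply: card_union_small leT _ => S cS; rewrite -cS; apply: card_no_edge DE' cS.
have b2 : #|bigs M (no_clique c0 c1 e R)| * 8 <= #|{ffun {set T} -> A}|.
  apply: card_union_small leT _ => S cS; rewrite -cS.
  exact: card_no_clique R1 cA m0 DE' Hc cS.
have b3 : #|bigs M (no_clique c1 c0 (compl e) R)| * 8 <= #|{ffun {set T} -> A}|.
  apply: card_union_small leT _ => S cS; rewrite -cS.
  exact: card_no_clique R1 cA m0 DE' Hi cS.
have [w] : exists w, w \notin bigs s (no_edge c0) :|: bigs s (no_edge c1) :|:
    bigs M (no_clique c0 c1 e R) :|: bigs M (no_clique c1 c0 (compl e) R).
  apply/existsP; rewrite -negb_forall; apply/negP => /forallP all_bad.
  set X := _ :|: _ in all_bad.
  have : #|X| = #|{ffun {set T} -> A}|.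
    by apply: eq_card => w; rewrite all_bad.
  have : #|X| <= #|bigs s (no_edge c0)| + #|bigs s (no_edge c1)| +
    #|bigs M (no_clique c0 c1 e R)| + #|bigs M (no_clique c1 c0 (compl e) R)|.
    rewrite (leq_trans (leq_card_setU _ _)) // leq_add2r.
    rewrite (leq_trans (leq_card_setU _ _)) // leq_add2r.
    exact: leq_card_setU.
  have : 0 < #|{ffun {set T} -> A}| by apply/card_gt0P; exists [ffun=> c0].
  lia.
rewrite !inE !negb_or -!andbA => /and4P[w0 w1 w2 w3].
have edges c k : w \notin bigs k (no_edge c) -> forall S : {set T}, k <= #|S| ->
    exists x y, [/\ x \in S, y \in S, x != y & w [set x; y] = c].
  move=> /bigcupP wk S kS; have [S' S'S cS'] := exists_subset_card kS.
  have : w \notin no_edge c S'.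
    by apply/negP => wS; apply: wk; exists S'; rewrite // inE cS'.
  rewrite inE => /allPn[p]; rewrite mem_enum => /pairsP[x [y [xS yS xy ->]]].
  by rewrite negbK => /eqP wc; exists x, y; rewrite !(subsetP S'S).
have cliques a b h k : w \notin bigs k (no_clique a b h R) ->
    forces_clique (noise a b h w) k R.
  move=> /bigcupP wk S kS; have [S' S'S cS'] := exists_subset_card kS.
  have : w \notin no_clique a b h R S'.
    by apply/negP => wS; apply: wk; exists S'; rewrite // inE cS'.
  rewrite inE negbK => /existsP[Q /and3P[QS /cliqueP cQ RQ]].
  by exists Q; split=> //; apply: subset_trans S'S.
exists (noise c0 c1 e w); split.
- exact: noise_simple.
- exact: cliques.
- by apply: forces_clique_ext (cliques _ _ _ _ w3) => x y; apply: compl_noise.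
- move=> S /(edges _ _ w0)[x [y [xS yS xy wxy]]]; exists x, y.
  by rewrite /noise xy wxy eqxx.
- move=> S /(edges _ _ w1)[x [y [xS yS xy wxy]]]; exists x, y.
  by rewrite -(compl_noise _ _ c01 xy) /noise xy wxy eqxx.
Qed.

(** * Iterating powers and noise *)

Lemma noise_scale a L D : 3 <= a -> L <= 2 ^ (2 * a) ->
  D = 2 * (2 ^ a) ^ 2 * (L + 3) -> 2 * D.+1 <= 2 ^ (5 * a).
Proof.
move=> a3 lL DE; pose x := 2 ^ a.
have x8 : 8 <= x by rewrite -[8]/(2 ^ 3) leq_exp2l.
have -> : 2 ^ (5 * a) = x ^ 5 by rewrite mulnC expnM.
have lL2 : L <= x ^ 2 by rewrite -expnM mulnC.
(* The estimate is 4x^4 + 12x^2 + 2 <= 8x^4 <= x^5. *)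
rewrite DE -/x; have -> : x ^ 5 = x * (x ^ 2 * x ^ 2) by rewrite !expnS expn0; lia.
have : 64 <= x ^ 2 by rewrite -[64]/(8 ^ 2) leq_exp2r.
move: (x ^ 2) lL2 => y; nia.
Qed.

(** Induction on [j]: a k-fold power multiplies the size exponent by k, then noise restores
    mixedness at 2^(5a). The bound k^(j+1) <= 2^(2a) keeps the cost of noise within a factor
    2^(5a). *)
Lemma iterated_graph (a k j : nat) :
  3 <= a -> a <= k -> k ^ j.+1 <= 2 ^ (2 * a) ->
  exists (T : finType) (f : rel T), [/\ simple_graph f, #|T| = 2 ^ (k ^ j.+1),
    forces_clique f (2 ^ (12 * k * (2 * a) ^ j)) (2 ^ a) /\
    forces_clique (compl f) (2 ^ (12 * k * (2 * a) ^ j)) (2 ^ a) &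
    forces_edge f (2 ^ (5 * a)) /\ forces_edge (compl f) (2 ^ (5 * a))].
Proof.
move=> a3 ak; have R1 : 1 < 2 ^ a by rewrite -{1}(expn0 2) ltn_exp2l // ltnW // ltnW.
elim: j => [|j IH] lek.
  pose T := 'I_(2 ^ (k ^ 1)).
  pose D := 2 * (2 ^ a) ^ 2 * (k ^ 1 + 3).
  have leD := noise_scale a3 lek (erefl D).
  (* The start graph has 2^k vertices, so the threshold 2^k + 1 is vacuous. *)
  have vac (e : rel T) : forces_clique e (2 ^ k).+1 (2 ^ a).
    move=> S; rewrite ltnNge (_ : #|S| <= 2 ^ k) //.
    by apply: leq_trans (max_card _) _; rewrite card_ord expn1.
  have [||f [gf c1 c2 e1 e2]] := noise_exists (L := k ^ 1) _ R1 (ltn0Sn _) _ (erefl D)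
    (vac (fun _ _ => false)) (vac _); rewrite ?card_ord //.
  exists T, f; rewrite card_ord expn0 muln1.
  have le1 : 2 * (2 ^ k).+1 * D.+1 <= 2 ^ (12 * k).
    apply: leq_trans (_ : 2 ^ k.+1 * 2 ^ (5 * a) <= _).
      rewrite expnS; have : 0 < 2 ^ k by rewrite expn_gt0.
      nia.
    by rewrite -expnD leq_exp2l //; lia.
  split=> //; split.
  - exact: forces_clique_leq le1 c1.
  - exact: forces_clique_leq le1 c2.
  - by apply: forces_edge_leq e1; lia.
  - by apply: forces_edge_leq e2; lia.
have k0 : 0 < k by lia.
have [T [e [ge cT [c1 c2] [e1 e2]]]] :
  exists (T : finType) (f : rel T), [/\ simple_graph f, #|T| = 2 ^ (k ^ j.+1),
    forces_clique f (2 ^ (12 * k * (2 * a) ^ j)) (2 ^ a) /\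
    forces_clique (compl f) (2 ^ (12 * k * (2 * a) ^ j)) (2 ^ a) &
    forces_edge f (2 ^ (5 * a)) /\ forces_edge (compl f) (2 ^ (5 * a))].
  by apply: IH; apply: leq_trans lek; rewrite leq_pexp2l.
set mu := 12 * k * (2 * a) ^ j in c1 c2.
have mu0 : 0 < mu by rewrite !muln_gt0 k0 expn_gt0; lia.
have [||U [f [gf cU fc fi]]] := lex_power k ge _ _ c1 c2 e1 e2.
- by rewrite expn_gt0.
- by rewrite -{1}(expn0 2) ltn_exp2l.
pose D := 2 * (2 ^ a) ^ 2 * (k ^ j.+2 + 3).
have leD := noise_scale a3 lek (erefl D).
have cU' : #|U| = 2 ^ (k ^ j.+2) by rewrite cU cT -expnM -expnSr.
(* Choosing b = a makes both terms of the minimum equal to R = 2^a. *)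
move: (fc a) (fi a); rewrite minnn => {}fc {}fi.
set m := _ * _ in fc fi.
have m0 : 0 < m by rewrite muln_gt0 !expn_gt0.
have [h [gh hc hi he hn]] :=
  noise_exists (proj1 gf) R1 m0 (eq_leq cU') (erefl D) fc fi.
exists U, h.
(* In exponents: 5a from noise, 5ak from s^k, a mu from m^a. The first two sum to at most 10ak <= a
   mu, as mu >= 12k. *)
have le1 : 2 * m * D.+1 <= 2 ^ (12 * k * (2 * a) ^ j.+1).
  rewrite mulnAC; apply: leq_trans (leq_mul leD (leqnn m)) _.
  rewrite /m -!expnM -!expnD leq_exp2l // expnS /mu.
  have : 1 <= (2 * a) ^ j by rewrite expn_gt0; lia.
  move: (_ ^ j) => z z1; nia.
split=> //; split.
- exact: forces_clique_leq le1 hc.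
- exact: forces_clique_leq le1 hi.
- by apply: forces_edge_leq he; lia.
- by apply: forces_edge_leq hn; lia.
Qed.

(** * Passing to induced subgraphs *)

Lemma forces_clique_induced (T U : finType) (g : T -> U) (f : rel U) m R :
  injective g -> forces_clique f m R -> forces_clique (relpre g f) m R.
Proof.
move=> injg Hf S mS.
have [C [CS cC RC]] : exists C : {set U},
    [/\ C \subset g @: S, is_clique f C & R <= #|C|].
  by apply: Hf; rewrite card_imset.
exists (g @^-1: C); split.
- apply/subsetP => x; rewrite inE => /(subsetP CS)/imsetP[y yS /injg ->].
  exact: yS.
- move=> x y; rewrite !inE => xC yC xy; apply: cC => //.
  by apply: contra_neq xy => /injg.
- apply: leq_trans RC _; rewrite -(card_imset _ injg) subset_leq_card //.
  apply/subsetP => u uC; have /imsetP[x _ ux] := subsetP CS _ uC.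
  by apply/imsetP; exists x; rewrite // inE -ux.
Qed.

From Stdlib Require Import ZArith Reals Lra.

(** * Choice of the parameters *)

Lemma locally_ramsey_forces (T : finType) (e : rel T) (m q : nat) (m' r : R) :
  (INR m <= m')%R -> (r <= INR q)%R ->
  forces_clique e m q -> forces_clique (compl e) m q -> locally_ramsey e m' r.
Proof.
move=> mm rR Hc Hi S m'S.
have mS : m <= #|S| by apply/leP/INR_le; lra.
split.
- have [C [CS cC /leP/le_INR RC]] := Hc S mS.
  by exists C; do 2?split=> //; lra.
- have [C [CS cC /leP/le_INR RC]] := Hi S mS.
  by exists C; do 2?split=> //; lra.
Qed.

Lemma INR_expn (b n : nat) : INR (expn b n) = (INR b ^ n)%R.
Proof. by elim: n => [|n IH] //=; rewrite expnS -multE mult_INR IH. Qed.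

Lemma nat_ceil (y : R) : (0 <= y)%R -> exists n : nat, (y <= INR n <= y + 1)%R.
Proof.
move=> y0; have [up1 up2] := archimed y; exists (Z.to_nat (up y)).
rewrite INR_IZR_INZ Z2Nat.id; first lra.
by apply: le_IZR; lra.
Qed.

Local Open Scope R_scope.

Lemma ln2_gt0 : 0 < ln 2.
Proof. by rewrite -ln_1; apply: ln_increasing; lra. Qed.

Lemma log2_le x y : 0 < x -> x <= y -> log2 x <= log2 y.
Proof.
move=> x0 xy; apply: Rmult_le_compat_r.
  by apply/Rlt_le/Rinv_0_lt_compat/ln2_gt0.
by case: xy => [xy|->]; [apply/Rlt_le/ln_increasing | apply: Rle_refl].
Qed.

Lemma log2_le_inv x y : 0 < x -> 0 < y -> log2 x <= log2 y -> x <= y.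
Proof.
move=> x0 y0; rewrite /log2 => /(Rmult_le_reg_r _ _ _ (Rinv_0_lt_compat _ ln2_gt0)).
case=> [lt|/ln_inv-> //]; [apply/Rlt_le/ln_lt_inv => // | apply: Rle_refl].
Qed.

Lemma log2_pow x n : 0 < x -> log2 (x ^ n) = INR n * log2 x.
Proof. by move=> x0; rewrite /log2 ln_pow //; field; have := ln2_gt0; lra. Qed.

Lemma log2_2 : log2 2 = 1.
Proof. by rewrite /log2; field; have := ln2_gt0; lra. Qed.

Lemma log2_mul x y : 0 < x -> 0 < y -> log2 (x * y) = log2 x + log2 y.
Proof. by move=> x0 y0; rewrite /log2 ln_mult //; field; have := ln2_gt0; lra. Qed.

Lemma log2_pow2 n : log2 (2 ^ n) = INR n.
Proof. by rewrite log2_pow ?log2_2; lra. Qed.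

Lemma Rpower_root x n : 0 < x -> (0 < n)%nat -> Rpower x (1 / INR n) ^ n = x.
Proof.
move=> x0 /ltP/lt_INR /= n0; rewrite -Rpower_pow; last exact: exp_pos.
rewrite Rpower_mult (_ : _ * _ = 1); last by field; lra.
exact: Rpower_1.
Qed.

(** Take a and k as log r and x = (log N)^(1/t) rounded up. With y = t^2 log r the main hypothesis
    reads y^t x <= log m; combined with m <= N it makes x and log r large enough to absorb the
    rounding. *)
Lemma ramsey_parameters (t N : nat) (m r : R) :
  (2 <= t)%nat -> (4 <= N)%nat -> 0 < m -> 0 < r -> m <= INR N ->
  INR t ^ (2 * t) * log2 r ^ t * Rpower (log2 (INR N)) (1 / INR t) <= log2 m ->
  INR t * log2 (log2 (INR N)) <= log2 r ->
  exists a k : nat, [/\ (3 <= a)%nat /\ (a <= k)%nat, (expn k t <= expn 2 (2 * a))%nat,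
    (N <= expn 2 (expn k t))%nat, r <= INR (expn 2 a) &
    INR (expn 2 (12 * k * expn (2 * a) t.-1)) <= m].
Proof.
move=> t2 N4 m0 r0 mN; set x := Rpower _ _; set rho := log2 r => Hm Hr.
have t2R : 2 <= INR t by have /leP/le_INR /= := t2; lra.
have N4R : 4 <= INR N by have /leP/le_INR /= := N4; lra.
have L2 : 2 <= log2 (INR N).
  have -> : 2 = log2 (2 ^ 2) by rewrite log2_pow2 /=; lra.
  by apply: log2_le; lra.
set L := log2 (INR N) in Hr x Hm L2.
have lL1 : 1 <= log2 L by rewrite -log2_2; apply: log2_le; lra.
have rho_t : INR t <= rho by nra.
have mL : log2 m <= L by exact: log2_le.
have x0 : 0 < x by exact: exp_pos.
have xt : x ^ t = L by apply: Rpower_root; [lra | apply: leq_trans t2].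
have lx : INR t * log2 x = log2 L by rewrite -log2_pow // xt.
pose y := INR t ^ 2 * rho.
have y4 : 4 * rho <= y 
  by apply: Rmult_le_compat_r; [lra | rewrite /=; nra].
have yt : INR t ^ (2 * t) * rho ^ t = y ^ t by rewrite /y Rpow_mult_distr -pow_mult.
rewrite yt in Hm.
have tE : t = t.-1.+1 by rewrite prednK // (leq_trans _ t2).
(* [Hm] and [mL] give y^t <= x^(t-1); if x < y this would force y <= 1. *)
have yx : y <= x.
  case: (Rle_lt_dec y x) => // xy; exfalso.
  have : x ^ t.-1 <= y ^ t.-1 by apply: pow_incr; lra.
  have : 0 < y ^ t.-1 by apply: pow_lt; lra.
  have : y ^ t <= x ^ t.-1.
    apply: (Rmult_le_reg_r x) => //.
    have -> : x ^ t.-1 * x = x ^ t by rewrite [in RHS]tE /= Rmult_comm.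
    lra.
  by rewrite tE /=; nra.
have L64 : 64 <= L.
  rewrite -xt; have : x ^ 2 <= x ^ t by apply: Rle_pow; [lra | apply/leP].
  by have : 64 <= x ^ 2 by [rewrite /=; nra]; lra.
have rho12 : 12 <= rho.
  have : 6 <= log2 L.
    have -> : 6 = log2 (2 ^ 6) by rewrite log2_pow2 /=; lra.
    by apply: log2_le; lra.
  by nra.
have [a [a1 a2]] : exists a : nat, rho <= INR a <= rho + 1 by apply: nat_ceil; lra.
have [k [k1 k2]] : exists k : nat, x <= INR k <= x + 1 by apply: nat_ceil; lra.
have INR2 : INR 2 = 2 by [].
exists a, k; split.
- split; apply/leP/INR_le; last lra.
  by rewrite /=; lra.
(* t log k <= t + t log x = t + log L, and both terms are at most rho <= a. *)
- apply/leP/INR_le; rewrite !INR_expn INR2; apply: log2_le_inv.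
  + by apply: pow_lt; lra.
  + by apply: pow_lt; lra.
  + rewrite log2_pow2 log2_pow; last lra.
    have : log2 (INR k) <= log2 (2 * x) by apply: log2_le; lra.
    rewrite log2_mul ?log2_2; try lra.
    rewrite -multE mult_INR INR2; nra.
- apply/leP/INR_le; rewrite !INR_expn INR2; apply: log2_le_inv; first lra.
    by apply: pow_lt; lra.
  rewrite log2_pow2 -/L -xt INR_expn; apply: pow_incr; lra.
- rewrite INR_expn INR2; apply: log2_le_inv => //; first by apply: pow_lt; lra.
  by rewrite log2_pow2.
- rewrite INR_expn INR2; apply: log2_le_inv => //; first by apply: pow_lt; lra.
  rewrite log2_pow2 -!multE !mult_INR INR_expn mult_INR INR2.
  apply: Rle_trans Hm.
  have a4 : (2 * INR a) ^ t.-1 <= y ^ t.-1 by apply: pow_incr; lra.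
  have y0 : 0 < y ^ t.-1 by apply: pow_lt; lra.
  have a0 : 0 <= (2 * INR a) ^ t.-1 by apply: pow_le; lra.
  have -> : y ^ t = y * y ^ t.-1 by rewrite {1}tE.
  have -> : INR 12 = 12 by rewrite /=; lra.
  (* k <= 2x and 2a <= y; then 24 <= y absorbs the constant. *)
  apply: Rle_trans (_ : 12 * (2 * x) * y ^ t.-1 <= _).
    by apply: Rmult_le_compat; lra.
  have := Rmult_lt_0_compat _ _ x0 y0; nra.
Qed.

Theorem theorem3p2 (t N : nat) (m r : R) :
  (2 <= t)%nat -> (4 <= N)%nat -> (0 < m)%R -> (0 < r)%R ->
  (INR t ^ (2 * t) * log2 r ^ t * Rpower (log2 (INR N)) (1 / INR t) <= log2 m)%R ->
  (INR t * log2 (log2 (INR N)) <= log2 r)%R ->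
  exists e : rel 'I_N, simple_graph e /\ locally_ramsey e m r.
Proof.
move=> t2 N4 m0 r0 Hm Hr.
(* If m > N no set is large enough, and the empty graph works. *)
have [mN|Nm] := Rle_lt_dec m (INR N); last first.
  exists (fun _ _ => false); split=> // S mS; exfalso.
  have /leP/le_INR : (#|S| <= N)%nat by rewrite -[leqRHS]card_ord max_card.
  lra.
have [a [k [[a3 ak] kt Nk ra am]]] := ramsey_parameters t2 N4 m0 r0 mN Hm Hr.
have tE : t = t.-1.+1 by rewrite prednK // (leq_trans _ t2).
(* The iteration runs up to j = t - 1, giving 2^(k^t) >= N vertices. *)
rewrite tE in kt Nk.
have [T [f [[sf jf] cT [fc fi] _]]] := iterated_graph a3 ak kt.
have NT : (N <= #|T|)%nat by rewrite cT.
pose g (i : 'I_N) : T := enum_val (widen_ord NT i).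
have injg : injective g by move=> i j /enum_val_inj/(congr1 val) /= /val_inj.
exists (relpre g f); split; first by split=> [i j|i] /=.
apply: (locally_ramsey_forces am ra); first exact: forces_clique_induced injg fc.
exact: (forces_clique_induced (f := compl f) injg fi).
Qed.
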